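(* For every $n\geq0$, $\mathsf{WKL}$ admits $n$-$\mathsf{ER}$-fairness preservation: for all $A_0,A_1\subseteq\mathbb{Q}$, every set $C$ which is $n$-$\mathsf{ER}$-fair for $A_0,A_1$, and every $C$-computable infinite binary tree $\mathcal{T}\subseteq 2^{<\omega}$, there is an infinite path $P$ through $\mathcal{T}$ such that $P\oplus C$ is $n$-$\mathsf{ER}$-fair for $A_0,A_1$.
   Context: Rationals are identified with natural numbers via a fixed computable coding; ''$>s$'' for rationals refers to their codes. For a finite set $S=\{x_0<_{\mathbb{Q}}\dots<_{\mathbb{Q}}x_{n-1}\}$, $\operatorname{int}_{\mathbb{Q}}(S)$ is the sequence of open intervals $(-\infty,x_0),(x_0,x_1),\dots,(x_{n-1},+\infty)$ ($\operatorname{int}_{\mathbb{Q}}(\emptyset)=\{\mathbb{Q}\}$); these are simple partitions. $\vec I$ refines $\vec J$ if each interval of $\vec I$ lies in an interval of $\vec J$; $\vec I\otimes\vec J=\{I\cap J\}$. An $m$-by-$n$ matrix $M$ is an array of rationals $x_{i,j}$ with $x_{i,j}<_{\mathbb{Q}}x_{i,k}$ for $j<k$; row $M(i)=\{x_{i,0},\dots,x_{i,n-1}\}$; $\operatorname{int}_{\mathbb{Q}}(M)=\bigotimes_{i<m}\operatorname{int}_{\mathbb{Q}}(M(i))$; an $M$-partition is a simple partition refining it. An $(\vec I,k)$-type is a tuple $T_0,\dots,T_{k-1}$ of intervals of $\vec I$. An $M$-formula has distinguished finite-set variables $U_j$ ($j<m$) and $C_{i,I}$ ($i<m$, $I\in\operatorname{int}_{\mathbb{Q}}(M(i))$);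 it is $\Sigma^{0,X}_1$ if $\Sigma^0_1$ in parameter $X$. An $M$-valuation $V$ consists of finite sets $A_j\subseteq\mathbb{Q}$ ($j<m$) and $D_{i,I}\subseteq I$; $\varphi(V)$ is the substitution. $V$ is of type $\vec T$ (an $(\vec I,m)$-type for an $M$-partition $\vec I$) if $A_j\subseteq T_j$ for all $j$; $V>s$ if all rationals occurring in $V$ have code $>s$. $\varphi$ is $\vec T$-essential if for every $s$ some $M$-valuation $V>s$ of type $\vec T$ satisfies $\varphi$; essential if $\vec T$-essential for some $M$-partition $\vec I$ and $(\vec I,m)$-type $\vec T$. $V$ diagonalizes against $A_0,A_1$ if $\bigcup_jA_j\subseteq A_1$ and for each $i<m$ some $I\in\operatorname{int}_{\mathbb{Q}}(M(i))$ has $D_{i,I}\subseteq A_0$. $X$ is $n$-$\mathsf{ER}$-fair for $A_0,A_1$ if for every $m$, every $m$-by-$2^nm$ matrix $M$ and every essential $\Sigma^{0,X}_1$ $M$-formula $\varphi$, some $M$-valuation diagonalizing against $A_0,A_1$ satisfies $\varphi$. *)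

(* Defs.v *)
From mathcomp Require Import all_boot all_order all_algebra finmap.
From mathcomp Require Import boolp classical_sets functions cardinality.
Set Implicit Arguments.
Unset Strict Implicit.
Unset Printing Implicit Defensive.
Import Order.TTheory GRing.Theory Num.Theory.
Local Open Scope classical_set_scope.
Local Open Scope ring_scope.

(* Kleene's schemes for partial functions nat^k -> nat with an oracle. *)
Inductive recfun : nat -> Type :=
| RZero k : recfun k
| RSucc : recfun 1
| RProj k (i : 'I_k) : recfun k
| ROracle : recfun 1
| RComp k l (f : recfun k) (g : 'I_k -> recfun l) : recfun l
| RPrim k (f : recfun k) (g : recfun k.+2) : recfun k.+1
| RMin k (f : recfun k.+1) : recfun k.

(* [prim_graph F G a x v]: v is the a-th value of the recursion
   h 0 x = F x, h b.+1 x = G (b, h b x, x). *)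
Fixpoint prim_graph k (F : k.-tuple nat -> nat -> Prop)
    (G : k.+2.-tuple nat -> nat -> Prop) (a : nat) (x : k.-tuple nat)
    (v : nat) : Prop :=
  match a with
  | 0%N => F x v
  | b.+1 => exists2 u, prim_graph F G b x u & G [tuple of [:: b, u & x]] v
  end.

(* [recfun_eval X f x v]: the computation of f on x with oracle X halts with
   value v.  Minimization halts at v only if f converges below v. *)
Fixpoint recfun_eval (X : set nat) k (f : recfun k) {struct f} :
    k.-tuple nat -> nat -> Prop :=
  match f in recfun k return k.-tuple nat -> nat -> Prop with
  | RZero _ => fun _ v => v = 0%N
  | RSucc => fun x v => v = (thead x).+1
  | RProj _ i => fun x v => v = tnth x i
  | ROracle => fun x v =>
      (X (thead x) /\ v = 1%N) \/ (~ X (thead x) /\ v = 0%N)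
  | RComp k _ f g => fun x v => exists2 y : k.-tuple nat,
      (forall i, recfun_eval X (g i) x (tnth y i)) & recfun_eval X f y v
  | RPrim _ f g => fun x v =>
      prim_graph (recfun_eval X f) (recfun_eval X g)
                 (thead x) [tuple of behead x] v
  | RMin _ f => fun x v =>
      recfun_eval X f [tuple of v :: x] 0%N /\
      forall w, (w < v)%N -> exists u, recfun_eval X f [tuple of w :: x] u.+1
  end.

Definition computable_in (X : set nat) k (R : set (k.-tuple nat)) : Prop :=
  exists f : recfun k, forall x,
    (R x -> recfun_eval X f x 1%N) /\ (~ R x -> recfun_eval X f x 0%N).

Definition Sigma1_in (X : set nat) k (R : set (k.-tuple nat)) : Prop :=
  exists2 S : set (k.+1.-tuple nat), computable_in X S &
    forall x, R x <-> exists y, S [tuple of y :: x].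

Definition join (X Y : set nat) : set nat :=
  [set z | if odd z then Y z./2 else X z./2].

(* Bijective base-2 numeration, a bijection from 2^{<omega} onto nat. *)
Fixpoint string_code (s : seq bool) : nat :=
  if s is b :: s' then ((string_code s').*2 + b).+1 else 0%N.

Definition binary_tree (T : set (seq bool)) : Prop :=
  forall s t, prefix s t -> T t -> T s.

Definition computable_tree (X : set nat) (T : set (seq bool)) : Prop :=
  computable_in X [set x : 1.-tuple nat | exists2 s, T s & string_code s = thead x].

Definition infinite_path (T : set (seq bool)) (P : nat -> bool) : Prop :=
  forall l, T (mkseq P l).

(* The order is the only structure on rat whose computability matters here. *)
Definition computable_coding (code : rat -> nat) : Prop :=
  bijective code /\
  computable_in set0
    [set p : 2.-tuple nat | exists x y : rat,
       [/\ code x = tnth p 0, code y = tnth p 1 & x < y]].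

(* Canonical index: the binary digits mark the codes of the elements. *)
Definition fset_code (code : rat -> nat) (S : {fset rat}) : nat :=
  (\sum_(x <- S) 2 ^ code x)%N.

(* ]-oo, x0[, ]x0, x1[, ..., ]x_{n-1}, +oo[: the left and the right endpoints
   are listed separately and then paired. *)
Definition intQ (S : {fset rat}) : seq (interval rat) :=
  let s := sort <=%R (enum_fset S) in
  [seq Interval b.1 b.2 |
     b <- zip (-oo%O :: [seq BRight x | x <- s])
              (rcons [seq BLeft x | x <- s] +oo%O)].

Definition simple_partition (Is : seq (interval rat)) : Prop :=
  exists S : {fset rat}, Is = intQ S.

Definition refines (Is Js : seq (interval rat)) : Prop :=
  forall a, a \in Is -> exists2 b, b \in Js & [set` a] `<=` [set` b].

Definition otimes (Is Js : seq (interval rat)) : seq (interval rat) :=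
  [seq Order.meet a b | a : interval rat <- Is, b : interval rat <- Js].

Section Matrices.
Variables (m n : nat).
Implicit Types (M : 'M[rat]_(m, n)).

Definition increasing_rows M : Prop :=
  forall i (j k : 'I_n), (j < k)%N -> M i j < M i k.

Definition row_set M (i : 'I_m) : {fset rat} := [fset M i j | j in 'I_n]%fset.

Definition intQ_mx M : seq (interval rat) :=
  \big[otimes/[:: `]-oo, +oo[ ]]_(i < m) intQ (row_set M i).

Definition mx_partition M (Is : seq (interval rat)) : Prop :=
  simple_partition Is /\ refines Is (intQ_mx M).

(* The k-th interval of int_Q(M(i)); see [size_intQ_row_set] below. *)
Definition row_itv M (i : 'I_m) (k : 'I_n.+1) : interval rat :=
  nth `]-oo, +oo[ (intQ (row_set M i)) k.

(* [inl j] is the variable U_j, and [inr (i, k)] is C_{i, I} for I the k-th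
   interval of int_Q(M(i)). *)
Definition mx_var : finType := ('I_m + 'I_m * 'I_n.+1)%type.

Definition assignment := mx_var -> {fset rat}.
Implicit Types (V : assignment).

Definition mx_valuation M V : Prop :=
  forall i k, [set` V (inr (i, k))] `<=` [set` row_itv M i k].

Definition assignment_code (code : rat -> nat) V : #|mx_var|.-tuple nat :=
  [tuple of [seq fset_code code (V v) | v : mx_var]].

(* A formula is represented by the set of assignments satisfying it. *)
Definition mx_formula := set assignment.
Implicit Types (phi : mx_formula).

Definition Sigma1_formula (code : rat -> nat) (X : set nat) phi : Prop :=
  exists2 R : set (#|mx_var|.-tuple nat), Sigma1_in X R &
    forall V, phi V <-> R (assignment_code code V).

Definition itv_type (Is : seq (interval rat)) k (T : k.-tuple (interval rat)) :=
  forall j, tnth T j \in Is.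

Definition of_type (T : m.-tuple (interval rat)) V : Prop :=
  forall j, [set` V (inl j)] `<=` [set` tnth T j].

Definition valuation_gt (code : rat -> nat) (s : nat) V : Prop :=
  forall v x, x \in V v -> (s < code x)%N.

Definition type_essential (code : rat -> nat) M (T : m.-tuple (interval rat))
    phi : Prop :=
  forall s, exists V, [/\ mx_valuation M V, valuation_gt code s V,
                          of_type T V & phi V].

Definition essential (code : rat -> nat) M phi : Prop :=
  exists Is T, [/\ mx_partition M Is, itv_type Is T &
                   type_essential code M T phi].

Definition diagonalizes (A0 A1 : set rat) V : Prop :=
  (\bigcup_j [set` V (inl j)] `<=` A1) /\
  (forall i, exists k, [set` V (inr (i, k))] `<=` A0).

End Matrices.

Definition ER_fair (code : rat -> nat) (n : nat) (A0 A1 : set rat)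
    (X : set nat) : Prop :=
  forall (m : nat) (M : 'M[rat]_(m, (2 ^ n * m)%N)), increasing_rows M ->
  forall phi : mx_formula m (2 ^ n * m)%N,
    Sigma1_formula code X phi -> essential code M phi ->
  exists V, [/\ mx_valuation M V, diagonalizes A0 A1 V & phi V].

Lemma size_intQ (S : {fset rat}) : size (intQ S) = #|` S|.+1.
Proof.
by rewrite size_map size_zip /= size_rcons !size_map size_sort minnn.
Qed.

Lemma size_intQ_row_set m n (M : 'M[rat]_(m, n)) (i : 'I_m) :
  increasing_rows M -> size (intQ (row_set M i)) = n.+1.
Proof.
move=> incM; rewrite size_intQ card_imfset /=; first by rewrite size_enum_ord.
move=> j k eqM; apply/val_inj; case: (ltngtP j k) => // /(incM i).
  by rewrite eqM ltxx.
by rewrite eqM ltxx.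
Qed.

(* Main.v *)
(* Forcing with nonempty closed subsets of Cantor space whose complement U is
   r.e. in C; we start from the paths of T.  For an M-formula phi with a
   Sigma_1 definition relative to P + C, and a type S, let psi(V) say that
   every P outside U has a sub-valuation of V satisfying phi.  By compactness
   psi is Sigma_1 in C.
   - If psi is S-essential, fairness of C yields a V that diagonalizes and
     satisfies psi; a path P0 outside U has a sub-valuation V' of V satisfying
     phi, and a finite prefix of P0 ensures this.
   - Otherwise psi fails for all valuations of type S above some s.  Removing
     the P for which such a valuation satisfies phi leaves a nonempty set:
     by compactness, it suffices that psi fails at the largest such valuation
     with codes below j, for every j.  Then phi is not S-essential.
   Treating the types one at a time avoids having to make phi fail to be
   essential for infinitely many types at once.  *)
Require Import Defs.
From mathcomp Require Import all_boot all_order all_algebra finmap.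
From mathcomp Require Import boolp classical_sets functions cardinality.
Set Implicit Arguments.
Unset Strict Implicit.
Unset Printing Implicit Defensive.
Local Open Scope classical_set_scope.

(** * Closure properties of the functions recursive in [C] *)

Definition env := nat -> nat.
Definition scons (a : nat) (e : env) : env := fun i => if i is j.+1 then e j else a.
Definition shift (e : env) : env := fun i => e i.+1.
Notation "a .: e" := (scons a e) (at level 55, right associativity).

Lemma scons_eta (e : env) : e 0 .: shift e = e.
Proof. by apply/funext => -[]. Qed.

Definition pre k (e : env) : k.-tuple nat := [tuple e i | i < k].

Lemma nth_pre k (e : env) i : i < k -> nth 0 (pre k e) i = e i.
Proof.
by move=> ik; rewrite -[i]/(nat_of_ord (Ordinal ik)) -tnth_nth tnth_mktuple.
Qed.

Lemma tuple_eq_nth k (x y : k.-tuple nat) :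
  (forall i, i < k -> nth 0 x i = nth 0 y i) -> x = y.
Proof. by move=> xy; apply: eq_from_tnth => i; rewrite !(tnth_nth 0) xy. Qed.

Lemma pre_nth k (x : k.-tuple nat) : pre k (nth 0 x) = x.
Proof. by apply: tuple_eq_nth => i ik; rewrite nth_pre. Qed.

Lemma pre_scons k a (e : env) : pre k.+1 (a .: e) = [tuple of a :: pre k e].
Proof.
by apply: tuple_eq_nth => -[|i] ik; rewrite nth_pre //= nth_pre.
Qed.

Lemma preS k (e : env) : pre k.+1 e = [tuple of e 0 :: pre k (shift e)].
Proof. by rewrite -{1}(scons_eta e) pre_scons. Qed.

Lemma thead_pre k (e : env) : thead (pre k.+1 e) = e 0.
Proof. by rewrite /thead tnth_mktuple. Qed.

Lemma behead_pre k (e : env) : [tuple of behead (pre k.+1 e)] = pre k (shift e).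
Proof.
by apply: tuple_eq_nth => i ik; rewrite nth_behead !nth_pre.
Qed.

(** Arguments come as one infinite sequence of which [f] reads the first [k] entries, so functions
    of different arities combine freely. *)
Definition recE (C : set nat) (F : env -> nat) : Prop :=
  exists k (f : recfun k), forall e, recfun_eval C f (pre k e) (F e).
Definition recB (C : set nat) (b : env -> bool) : Prop := recE C (fun e => b e).

Section Recursive.
Variable C : set nat.

Lemma recE_ext F G : recE C F -> F =1 G -> recE C G.
Proof. by move=> Fr /funext <-. Qed.

Lemma recE_proj i : recE C (fun e => e i).
Proof. by exists i.+1, (RProj ord_max) => e /=; rewrite tnth_mktuple. Qed.

Lemma recE_widen k (f : recfun k) F K : k <= K ->
  (forall e, recfun_eval C f (pre k e) (F e)) ->
  exists g : recfun K, forall e, recfun_eval C g (pre K e) (F e).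
Proof.
move=> kK fF; exists (RComp f (fun i => RProj (widen_ord kK i))) => e /=.
by exists (pre k e) => // i; rewrite !tnth_mktuple.
Qed.

(** Only the [X e i] with [i < k] are read, and a common arity [K] serves these finitely many
    functions; hence pointwise recursiveness of [X] suffices. *)
Lemma recE_comp F (X : env -> env) : recE C F ->
  (forall i, recE C (fun e => X e i)) -> recE C (fun e => F (X e)).
Proof.
move=> [k [f fF]] GR.
have [K KP] : exists K, forall i, i < k ->
    exists g : recfun K, forall e, recfun_eval C g (pre K e) (X e i).
  elim: k {f fF} => [|k [K KP]]; first by exists 0.
  have [k' [g gG]] := GR k.
  exists (maxn K k') => i; rewrite ltnS leq_eqVlt => /predU1P[->|/KP[h hG]].
    by apply: recE_widen gG; rewrite leq_maxr.
  by apply: recE_widen hG; rewrite leq_maxl.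
have [g gP] := choice (fun i : 'I_k => KP i (ltn_ord i)).
exists K, (RComp f g) => e /=; exists (pre k (X e)) => // i.
by rewrite tnth_mktuple.
Qed.

Lemma recE_const c : recE C (fun=> c).
Proof.
elim: c => [|c IH]; first by exists 0, (RZero 0).
apply: (@recE_comp (fun e => (e 0).+1) (fun _ _ => c)) => //.
by exists 1, RSucc => e /=; rewrite thead_pre.
Qed.

Lemma recE_comp1 (h : nat -> nat) F : recE C (fun e => h (e 0)) -> recE C F ->
  recE C (fun e => h (F e)).
Proof. by move=> hr Fr; apply: (@recE_comp _ (fun e _ => F e) hr). Qed.

Lemma recE_comp2 (h : nat -> nat -> nat) F G :
  recE C (fun e => h (e 0) (e 1)) -> recE C F -> recE C G ->
  recE C (fun e => h (F e) (G e)).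
Proof.
move=> hr Fr Gr.
by apply: (@recE_comp _ (fun e i => if i is 0 then F e else G e) hr) => -[].
Qed.

Lemma recE_scons F G : recE C F -> (forall i, recE C (fun e => G e i)) ->
  forall i, recE C (fun e => (F e .: G e) i).
Proof. by move=> Fr Gr []. Qed.

Lemma recE_succ F : recE C F -> recE C (fun e => (F e).+1).
Proof.
by apply: (@recE_comp1 succn); exists 1, RSucc => e /=; rewrite thead_pre.
Qed.

Fixpoint primrec (F G : env -> nat) (a : nat) (e : env) : nat :=
  if a is b.+1 then G (b .: (primrec F G b e .: e)) else F e.

Lemma recE_primrec F G : recE C F -> recE C G ->
  recE C (fun e => primrec F G (e 0) (shift e)).
Proof.
move=> [k [f fF]] [l [g gG]]; pose K := maxn k l.
have [f' {}fF] := recE_widen (leq_maxl k l : k <= K) fF.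
have lK : l <= K.+2 by rewrite !leqW // leq_maxr.
have [g' {}gG] := recE_widen lK gG.
exists K.+1, (RPrim f' g') => e /=; rewrite thead_pre behead_pre.
elim: (e 0) => [|a IH] //=; exists (primrec F G a (shift e)) => //.
have := gG (a .: (primrec F G a (shift e) .: shift e)).
rewrite !pre_scons.
by congr (recfun_eval C g' _ _); apply: val_inj.
Qed.

Lemma recE_pred F : recE C F -> recE C (fun e => (F e).-1).
Proof.
apply: recE_comp1.
apply: (recE_ext (recE_primrec (recE_const 0) (recE_proj 0))) => e.
by case: (e 0).
Qed.

Lemma recE_add F G : recE C F -> recE C G -> recE C (fun e => F e + G e).
Proof.
apply: recE_comp2.
apply: (recE_ext (recE_primrec (recE_proj 0) (recE_succ (recE_proj 1)))) => e.
by elim: (e 0) => //= n ->.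
Qed.

Lemma recE_mul F G : recE C F -> recE C G -> recE C (fun e => F e * G e).
Proof.
apply: recE_comp2.
apply: (recE_ext (recE_primrec (recE_const 0)
  (recE_add (recE_proj 2) (recE_proj 1)))) => e.
by elim: (e 0) => //= n ->; rewrite mulSn.
Qed.

Lemma recE_sub F G : recE C F -> recE C G -> recE C (fun e => F e - G e).
Proof.
move=> Fr Gr; apply: (@recE_comp2 (fun n m => m - n)) Gr Fr.
apply: (recE_ext (recE_primrec (recE_proj 0) (recE_pred (recE_proj 1)))) => e.
by elim: (e 0) => [|n IH] /=; rewrite ?subn0 // IH subnS.
Qed.

Lemma recE_exp F G : recE C F -> recE C G -> recE C (fun e => F e ^ G e).
Proof.
move=> Fr Gr; apply: (@recE_comp2 (fun n m => m ^ n)) Gr Fr.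
apply: (recE_ext (recE_primrec (recE_const 1)
  (recE_mul (recE_proj 2) (recE_proj 1)))) => e.
by elim: (e 0) => [|n IH] //=; rewrite IH expnS.
Qed.

Lemma recB_leq F G : recE C F -> recE C G -> recB C (fun e => F e <= G e).
Proof.
move=> Fr Gr.
apply: (recE_ext (recE_sub (recE_const 1) (recE_sub Fr Gr))) => e.
by rewrite /leq; case: (F e - G e).
Qed.

Lemma recB_not b : recB C b -> recB C (fun e => ~~ b e).
Proof.
by move=> br; apply: (recE_ext (recE_sub (recE_const 1) br)) => e; case: (b e).
Qed.

Lemma recB_and b c : recB C b -> recB C c -> recB C (fun e => b e && c e).
Proof.
move=> br cr; apply: (recE_ext (recE_mul br cr)) => e.
by case: (b e); case: (c e).
Qed.

Lemma recB_or b c : recB C b -> recB C c -> recB C (fun e => b e || c e).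
Proof.
move=> br cr; apply: (recE_ext (recB_not (recB_and (recB_not br) (recB_not cr)))).
by move=> e; rewrite negb_and !negbK.
Qed.

Lemma recB_eq F G : recE C F -> recE C G -> recB C (fun e => F e == G e).
Proof.
move=> Fr Gr; apply: (recE_ext (recB_and (recB_leq Fr Gr) (recB_leq Gr Fr))) => e.
by rewrite eqn_leq.
Qed.

Lemma recE_if b F G : recB C b -> recE C F -> recE C G ->
  recE C (fun e => if b e then F e else G e).
Proof.
move=> br Fr Gr; apply: (recE_ext (recE_add (recE_mul br Fr)
  (recE_mul (recB_not br) Gr))) => e.
by case: (b e); rewrite ?mul1n ?addn0.
Qed.

Lemma recE_mod F G : recE C F -> recE C G -> recE C (fun e => F e %% G e).
Proof.
apply: recE_comp2.
(* In the recursion [e 1] is the previous remainder and [e 2] the divisor. For divisor 0 the test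
   never succeeds, in agreement with [modn0]. *)
have br : recB C (fun e => (e 1).+1 == e 2).
  by apply: recB_eq; [apply: recE_succ|]; apply: recE_proj.
apply: (recE_ext (recE_primrec (recE_const 0)
  (recE_if br (recE_const 0) (recE_succ (recE_proj 1))))) => e.
elim: (e 0) => [|m IH] /=; first by rewrite mod0n.
rewrite IH modnS /shift /dvdn -(addn1 m) -modnDml addn1.
case: (posnP (e 1)) => [->|d0]; first by rewrite modn0.
have := ltn_pmod m d0; rewrite leq_eqVlt => /predU1P[->|lt].
  by rewrite eqxx modnn.
by rewrite (modn_small lt) (ltn_eqF lt).
Qed.

Lemma recE_div F G : recE C F -> recE C G -> recE C (fun e => F e %/ G e).
Proof.
apply: recE_comp2.
have br : recB C (fun e => 0 < e 2).
  by apply: recB_leq; [apply: recE_const|apply: recE_proj].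
(* The quotient grows by one exactly at the multiples of the divisor. *)
have cr : recB C (fun e => (e 0).+1 %% e 2 == 0).
  by apply: recB_eq; [apply: recE_mod; [apply: recE_succ|]|apply: recE_const];
     apply: recE_proj.
apply: (recE_ext (recE_primrec (recE_const 0)
  (recE_if br (recE_add cr (recE_proj 1)) (recE_const 0)))) => e.
elim: (e 0) => [|m IH] /=; first by rewrite div0n.
rewrite IH /shift; case: posnP => [->|d0]; first by rewrite divn0.
by rewrite divnS.
Qed.

Lemma recB_bex (b : nat -> env -> bool) N :
  recB C (fun e => b (e 0) (shift e)) -> recE C N ->
  recB C (fun e => has (fun i => b i e) (iota 0 (N e))).
Proof.
move=> br Nr.
suff hr : recB C (fun e => has (fun i => b i (shift e)) (iota 0 (e 0))).
  have Gr i : recE C (fun e => (N e .: e) i).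
    exact: (recE_scons (G := id) Nr recE_proj).
  exact: (recE_comp hr Gr).
have cr : recB C (fun e => (0 < e 1) || b (e 0) (shift (shift e))).
  apply: recB_or; first by apply: recB_leq; [apply: recE_const|apply: recE_proj].
  apply: (recE_comp (X := fun e => e 0 .: shift (shift e)) br).
  by apply: recE_scons => [|i]; apply: recE_proj.
apply: (recE_ext (recE_primrec (recE_const 0) cr)) => e.
elim: (e 0) => [//|m IH].
have -> : iota 0 m.+1 = rcons (iota 0 m) m by rewrite -addn1 iotaD cats1.
by rewrite has_rcons orbC /= IH; case: has.
Qed.

Lemma recB_ball (b : nat -> env -> bool) N :
  recB C (fun e => b (e 0) (shift e)) -> recE C N ->
  recB C (fun e => all (fun i => b i e) (iota 0 (N e))).
Proof.
move=> br Nr; apply: (recE_ext (recB_not (recB_bex (recB_not br) Nr))) => e.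
congr (nat_of_bool _); rewrite -all_predC.
by apply: eq_all => i; apply: negbK.
Qed.

Lemma recB_oracle : recB C (fun e => `[< C (e 0) >]).
Proof.
exists 1, ROracle => e /=; rewrite thead_pre.
by case: asboolP => ?; [left|right].
Qed.

End Recursive.

(** * Coding of finite sequences, finite sets and binary prefixes *)

(** The pair [N], [w] codes a finite sequence by its base [N + 1] digits, in the role of Goedel's
    beta function. *)
Definition digit N w i := (w %/ N.+1 ^ i) %% N.+1.

Lemma digit_exist (u : nat -> nat) k :
  exists N w, forall i, i < k -> digit N w i = u i.
Proof.
exists (\max_(i < k) u i).
have : forall i, i < k -> u i <= \max_(i < k) u i.
  by move=> i ik; apply: (leq_bigmax (F := fun i : 'I_k => u i) (Ordinal ik)).
move: (\max_(i < k) u i) => N; elim: k u => [|k IH] u uN; first by exists 0.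
have [i ik|w wP] := IH (u \o succn); first exact: uN.
exists (w * N.+1 + u 0) => -[|i] ik; rewrite /digit.
  by rewrite divn1 modnMDl modn_small // ltnS uN.
rewrite expnS divnMA divnMDl // (divn_small (_ : u 0 < N.+1)) ?ltnS ?uN //.
by rewrite addn0; apply: wP.
Qed.

Definition bit w i := odd (w %/ 2 ^ i).

Lemma bit0 w : bit w 0 = odd w.
Proof. by rewrite /bit divn1. Qed.

Lemma bitS w i : bit w i.+1 = bit w./2 i.
Proof. by rewrite /bit expnS divnMA divn2. Qed.

(** Holds because [i < 2 ^ i <= w]. It bounds quantifiers over the elements of a coded finite
    set. *)
Lemma bit_lt w i : bit w i -> i < w.
Proof.
rewrite /bit => wi; apply: leq_trans (ltn_expl i (ltnSn 1)) _.
by rewrite leqNgt; apply: contraL wi => /divn_small ->.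
Qed.

Lemma bit_sum (s : seq nat) i : uniq s -> bit (\sum_(c <- s) 2 ^ c) i = (i \in s).
Proof.
(* Halving the sum drops the exponent 0 and lowers all others by one, which matches [bitS]. *)
have half_sum (r : seq nat) : uniq r ->
    \sum_(c <- r) 2 ^ c =
    (0 \in r) + (\sum_(c <- [seq c.-1 | c <- r & 0 < c]) 2 ^ c).*2.
  elim: r => [|c r IH]; first by rewrite !big_nil.
  rewrite cons_uniq big_cons in_cons => /andP[cr /IH ->].
  case: c cr => [/negPf->|c _] /=; first by rewrite add0n.
  by rewrite big_cons doubleD addnCA expnS mul2n.
elim: i s => [|i IH] s us; rewrite half_sum //.
  by rewrite bit0 oddD odd_double addbF; case: (_ \in _).
rewrite bitS half_bit_double IH.
  apply/mapP/idP => [[[|c]]|si]; last by exists i.+1; rewrite // mem_filter.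
    by rewrite mem_filter.
  by rewrite mem_filter => /= cs ->.
rewrite map_inj_in_uniq ?filter_uniq // => -[|a] [|b]; rewrite !mem_filter //=.
by move=> _ _ ->.
Qed.

(** The prefix of [P] of length [l] as a binary number, least significant digit first. *)
Fixpoint pw (P : nat -> bool) l :=
  if l is l'.+1 then P 0 + (pw (P \o succn) l').*2 else 0.

Lemma bit_pw P l i : i < l -> bit (pw P l) i = P i.
Proof.
elim: l P i => // l IH P [|i] il /=.
  by rewrite bit0 oddD odd_double addbF; case: (P 0).
by rewrite bitS half_bit_double IH.
Qed.

Lemma pw_lt P l : pw P l < 2 ^ l.
Proof.
elim: l P => //= l IH P; rewrite expnS mul2n.
by have := IH (P \o succn); case: (P 0); rewrite ?add0n ?add1n ?ltn_Sdouble ?ltn_double.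
Qed.

Lemma pw_ext P Q l : (forall i, i < l -> P i = Q i) -> pw P l = pw Q l.
Proof.
elim: l P Q => //= l IH P Q PQ; rewrite PQ // (IH _ (Q \o succn)) // => i il.
exact: PQ.
Qed.

Lemma pw_bit w l : w < 2 ^ l -> pw (bit w) l = w.
Proof.
elim: l w => [[]//|l IH] w wl /=.
rewrite (@pw_ext _ (bit w./2)) => [|i _]; last exact: bitS.
rewrite IH ?bit0 ?odd_double_half // -ltn_double -[(2 ^ l).*2]mul2n -expnS.
by apply: leq_ltn_trans wl; rewrite -[leqRHS]odd_double_half leq_addl.
Qed.

Lemma pw_eqP P l w :
  pw P l = w <-> w < 2 ^ l /\ forall i, i < l -> bit w i = P i.
Proof.
split=> [<-|[wl wP]]; first by split=> [|i]; [apply: pw_lt|apply: bit_pw].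
by rewrite -(pw_bit wl); apply: pw_ext => i /wP.
Qed.

Lemma mkseq_head T (P : nat -> T) l : mkseq P l.+1 = P 0 :: mkseq (P \o succn) l.
Proof. by rewrite /mkseq /= -(addn0 1) iotaDl -map_comp. Qed.

(** Bijective base 2 raises each digit by one, which adds [1 + 2 + ... + 2 ^ (l - 1)], that is
    [2 ^ l - 1]. *)
Lemma string_code_mkseq P l : (string_code (mkseq P l)).+1 = pw P l + 2 ^ l.
Proof.
elim: l P => // l IH P; rewrite mkseq_head /=.
by rewrite expnS mul2n -addnA -doubleD -IH doubleS !addnS addnC.
Qed.

Lemma string_code_inj : injective string_code.
Proof.
elim=> [|a s IH] [|b t] //= [/(f_equal (fun n => (odd n, n./2)))].
by rewrite !(addnC _.*2) !oddD !odd_double !half_bit_double !addbF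
  => -[]; case: a; case: b => // _ /IH->.
Qed.

Arguments pw : simpl never.

(** * Compactness of Cantor space *)

(** Proved as in Koenig's lemma, by extending bit by bit a string whose cylinder is covered by no
    single [O j]. *)
Lemma increasing_open_not_cover (O : nat -> set (nat -> bool)) :
  (forall j P, O j P -> exists l, forall Q, (forall i, i < l -> Q i = P i) -> O j Q) ->
  (forall j P, O j P -> O j.+1 P) ->
  (forall j, exists P, ~ O j P) ->
  exists P, forall j, ~ O j P.
Proof.
move=> Oopen Oincr Oproper.
have {Oincr} Ole j k P : j <= k -> O j P -> O k P.
  by move=> /subnK<-; elim: (k - j) => // m IH /IH /Oincr.
pose alive (s : seq bool) := forall j, exists2 P, ~ O j P & mkseq P (size s) = s.
have alive_step s : alive s -> exists b, alive (rcons s b).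
  move=> as_; apply: contrapT => /forallNP dead.
  (* If both extensions of [s] die, at [j1] and [j2], then by monotonicity [O (maxn j1 j2)] covers
     the whole cylinder of [s]. *)
  have /existsNP[j1 j1P] := dead true; have /existsNP[j2 j2P] := dead false.
  have [P PO Ps] := as_ (maxn j1 j2).
  have PS : mkseq P (size (rcons s (P (size s)))) = rcons s (P (size s)).
    by rewrite size_rcons mkseqS Ps.
  case Pb : (P (size s)) PS => PS.
    by apply: j1P; exists P => // /(Ole _ _ _ (leq_maxl j1 j2)).
  by apply: j2P; exists P => // /(Ole _ _ _ (leq_maxr j1 j2)).
have /choice[next nextP] s : exists b, alive s -> alive (rcons s b).
  by have [/alive_step[b ab]|nas] := pselect (alive s); [exists b|exists true].
pose p n := iter n (fun s => rcons s (next s)) [::].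
have p_alive n : alive (p n).
  elim: n => [j|n IH] /=; last exact: nextP.
  by have [P PO] := Oproper j; exists P.
have size_p n : size (p n) = n by elim: n => //= n IH; rewrite size_rcons IH.
pose P i := next (p i).
have pP n : p n = mkseq P n by elim: n => [//|n IH]; rewrite mkseqS -IH.
(* If [O j] contained [P], it would contain the cylinder of some prefix of [P], but all these
   prefixes are alive. *)
exists P => j /Oopen[l lP]; have [Q QO] := p_alive l j.
rewrite size_p pP => PQ; apply/QO/lP => i il.
by rewrite -(nth_mkseq false Q il) PQ nth_mkseq.
Qed.

(** * Uniformly open and r.e. families and their closure properties *)

Lemma recE_digit C F G H : recE C F -> recE C G -> recE C H ->
  recE C (fun e => digit (F e) (G e) (H e)).
Proof.
move=> Fr Gr Hr; have F1r := recE_succ Fr.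
exact: recE_mod (recE_div Gr (recE_exp F1r Hr)) F1r.
Qed.

Lemma recB_bit C F G : recE C F -> recE C G -> recB C (fun e => bit (F e) (G e)).
Proof.
move=> Fr Gr; have r2 := recE_const C 2.
apply: (recE_ext (recE_mod (recE_div Fr (recE_exp r2 Gr)) r2)) => e.
by rewrite modn2.
Qed.

(* A uniformly open and C-r.e. family: membership of P is witnessed by a finite
   prefix of P, coded by its length l and its binary value [pw P l].  Requiring
   b to be monotone in l lets l bound the unbounded quantifiers as well. *)
Definition ure (C : set nat) (D : (nat -> bool) -> env -> Prop) : Prop :=
  exists b : env -> bool,
    [/\ recB C b,
        forall P e l, b (l .: pw P l .: e) -> b (l.+1 .: pw P l.+1 .: e) &
        forall P e, D P e <-> exists l, b (l .: pw P l .: e)].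

Lemma prefix_mono (b : env -> bool) P e :
  (forall l, b (l .: pw P l .: e) -> b (l.+1 .: pw P l.+1 .: e)) ->
  forall l l', l <= l' -> b (l .: pw P l .: e) -> b (l' .: pw P l' .: e).
Proof. by move=> bS l l' /subnK<-; elim: (l' - l) => // n IH /IH/bS. Qed.

Section UniformlyRe.
Variable C : set nat.
Implicit Types D E : (nat -> bool) -> env -> Prop.

Lemma ure_ext D E : ure C D -> (forall P e, D P e <-> E P e) -> ure C E.
Proof.
by move=> [b [br bS bP]] DE; exists b; split=> // P e; rewrite -DE.
Qed.

Lemma ure_rec b : recB C b -> ure C (fun _ e => b e).
Proof.
move=> br; exists (fun e => b (shift (shift e))); split=> //.
  by apply: (recE_comp br) => i; apply: recE_proj.
by move=> P e; split=> [be|[]]; first exists 0.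
Qed.

Lemma ure_const (Q : Prop) : ure C (fun _ _ => Q).
Proof.
apply: (ure_ext (ure_rec (recE_const C `[< Q >]))) => P e.
by split=> /asboolP.
Qed.

Lemma ure_oracle c : ure C (fun P e => P (e 0) = c).
Proof.
(* Here [e 0] is the length and [e 1] the value of the prefix; the queried position [e 2] must lie
   inside it. *)
exists (fun e => (e 2 < e 0) && ~~ (bit (e 1) (e 2) (+) c)); split.
- apply: recB_and.
    by apply: recB_leq; [apply: recE_succ|]; apply: recE_proj.
  have br : recB C (fun e => bit (e 1) (e 2)).
    by apply: recB_bit; apply: recE_proj.
  case: c; last by apply: (recE_ext (recB_not br)) => e; rewrite addbF.
  by apply: (recE_ext br) => e; rewrite addbT negbK.
- move=> P e l /= /andP[el]; rewrite !bit_pw ?leqW // => ->.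
move=> P e; split=> [Pe|[l /= /andP[el]]]; last first.
  by rewrite bit_pw //; case: (P _); case: c.
by exists (e 0).+1 => /=; rewrite bit_pw // Pe addbb ltnSn.
Qed.

Lemma ure_comp D (X : env -> env) : ure C D ->
  (forall i, recE C (fun e => X e i)) -> ure C (fun P e => D P (X e)).
Proof.
move=> [b [br bS bP]] Xr.
exists (fun e => b (e 0 .: e 1 .: X (shift (shift e)))); split=> /= [|P e l|].
- apply: (recE_comp br); apply: recE_scons; first exact: recE_proj.
  apply: recE_scons => [|i]; first exact: recE_proj.
  by apply: (recE_comp (Xr i)) => j; apply: recE_proj.
- exact: bS.
by move=> P e; rewrite bP.
Qed.

Lemma ure_and D E : ure C D -> ure C E -> ure C (fun P e => D P e /\ E P e).
Proof.
move=> [b [br bS bP]] [c [cr cS cP]]; exists (fun e => b e && c e); split.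
- exact: recB_and.
- by move=> P e l /andP[/bS-> /cS->].
move=> P e; rewrite bP cP; split=> [[[l bl] [m cm]]|[l /andP[bl cl]]]; last first.
  by split; exists l.
exists (maxn l m); rewrite (prefix_mono (bS P e) (leq_maxl l m)) //.
by rewrite (prefix_mono (cS P e) (leq_maxr l m)).
Qed.

Lemma ure_or D E : ure C D -> ure C E -> ure C (fun P e => D P e \/ E P e).
Proof.
move=> [b [br bS bP]] [c [cr cS cP]]; exists (fun e => b e || c e); split.
- exact: recB_or.
- by move=> P e l /orP[/bS->|/cS->]; rewrite ?orbT.
move=> P e; rewrite bP cP; split=> [[[l bl]|[l cl]]|[l /orP[bl|cl]]].
- by exists l; rewrite bl.
- by exists l; rewrite cl orbT.
- by left; exists l.
- by right; exists l.
Qed.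

Lemma recB_under_prefix b : recB C b ->
  recB C (fun e => b (e 1 .: e 2 .: e 0 .: shift (shift (shift e)))).
Proof.
move=> br; apply: (recE_comp br).
by do !(apply: recE_scons; first exact: recE_proj); move=> i; apply: recE_proj.
Qed.

Lemma ure_ex (D : (nat -> bool) -> nat -> env -> Prop) :
  ure C (fun P e => D P (e 0) (shift e)) -> ure C (fun P e => exists y, D P y e).
Proof.
move=> [b [br bS bP]].
exists (fun e => has (fun y => b (e 0 .: e 1 .: y .: shift (shift e))) (iota 0 (e 0))).
have bP' P y e : D P y e <-> exists l, b (l .: pw P l .: y .: e).
  exact: (bP P (y .: e)).
split.
- exact: recB_bex (recB_under_prefix br) (recE_proj C 0).
- move=> P e l /hasP[y]; rewrite mem_iota => /andP[_ yl] /bS by1.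
  by apply/hasP; exists y => //; rewrite mem_iota; apply: leqW yl.
move=> P e; split=> [[y /bP'[l bl]]|[l /= /hasP[y _ bl]]]; last first.
  by exists y; apply/bP'; exists l.
exists (maxn l y.+1); apply/hasP; exists y; first by rewrite mem_iota; apply: leq_maxr.
exact: (prefix_mono (bS P (y .: e)) (leq_maxl _ _) bl).
Qed.

(** Each of the finitely many [y] has its own witnessing prefix; by monotonicity the longest serves
    them all. *)
Lemma ure_ball (D : (nat -> bool) -> nat -> env -> Prop) N :
  ure C (fun P e => D P (e 0) (shift e)) -> recE C N ->
  ure C (fun P e => forall y, y < N e -> D P y e).
Proof.
move=> [b [br bS bP]] Nr.
exists (fun e => all (fun y => b (e 0 .: e 1 .: y .: shift (shift e)))
                     (iota 0 (N (shift (shift e))))).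
have bP' P y e : D P y e <-> exists l, b (l .: pw P l .: y .: e).
  exact: (bP P (y .: e)).
split.
- apply: (recB_ball (recB_under_prefix br)).
  by apply: (recE_comp Nr) => i; apply: recE_proj.
- by move=> P e l /allP bl; apply/allP => y /bl /bS.
move=> P e; split=> [Dy|[l /= /allP bl] y yN]; last first.
  by apply/bP'; exists l; apply: bl; rewrite mem_iota.
have [l lP] : exists l, forall y, y < N e -> b (l .: pw P l .: y .: e).
  elim: (N e) Dy => [|n IH] Dy; first by exists 0.
  have [y yn|l lP] := IH; first exact/Dy/ltnW.
  have /bP'[m mP] := Dy n (ltnSn n).
  exists (maxn l m) => y; rewrite ltnS leq_eqVlt => /predU1P[->|yn].
    exact: (prefix_mono (bS P _) (leq_maxr _ _) mP).
  exact: (prefix_mono (bS P _) (leq_maxl _ _) (lP y yn)).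
by exists l; apply/allP => y; rewrite mem_iota => /lP.
Qed.

Lemma ure_all_in (I : eqType) (s : seq I) (D : I -> (nat -> bool) -> env -> Prop) :
  (forall i, ure C (D i)) -> ure C (fun P e => forall i, i \in s -> D i P e).
Proof.
move=> Dr; elim: s => [|a s IH].
  by apply: (ure_ext (ure_const True)).
apply: (ure_ext (ure_and (Dr a) IH)) => P e; split=> [[Da Ds] i|Ds].
  by rewrite in_cons => /predU1P[->|/Ds].
by split=> [|i si]; apply: Ds; rewrite in_cons ?eqxx ?si ?orbT.
Qed.

Lemma ure_all (I : finType) (D : I -> (nat -> bool) -> env -> Prop) :
  (forall i, ure C (D i)) -> ure C (fun P e => forall i, D i P e).
Proof.
move=> Dr; apply: (ure_ext (ure_all_in (enum I) Dr)) => P e.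
by split=> Di i => [|_]; apply: Di; rewrite mem_enum.
Qed.

(** A tuple is read off as digits, so the quantifier over tuples becomes two quantifiers over
    numbers, [N] and [w]. *)
Lemma ure_ex_tuple k (D : (nat -> bool) -> k.-tuple nat -> env -> Prop) :
  ure C (fun P e => D P (pre k e) (fun i => e (k + i))) ->
  ure C (fun P e => exists y, D P y e).
Proof.
move=> Dr.
pose X (e : env) i := if i < k then digit (e 1) (e 0) i else e (i - k).+2.
have Xr i : recE C (fun e => X e i).
  rewrite /X; case: (i < k); last exact: recE_proj.
  exact: recE_digit (recE_proj C 1) (recE_proj C 0) (recE_const C i).
have Xk N w e : (fun i => X (w .: N .: e) (k + i)) = e.
  by apply/funext => i; rewrite /X ltnNge leq_addr /= addKn.
apply: ure_ext (ure_ex (D := fun P N e => exists w, D P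
  (pre k (X (w .: N .: e))) (fun i => X (w .: N .: e) (k + i))) _) _.
  apply: ure_ex; apply: (ure_ext (ure_comp Dr Xr)) => P e.
  by rewrite (scons_eta (shift e)) scons_eta.
move=> P e; split=> [[N [w]]|[y Dy]]; first by rewrite Xk; exists (pre k (X (w .: N .: e))).
have [N [w yP]] := digit_exist (nth 0 y) k; exists N, w; rewrite Xk.
suff -> : pre k (X (w .: N .: e)) = y by [].
by apply: tuple_eq_nth => i ik; rewrite nth_pre // /X ik yP.
Qed.

(** The recursion is replaced by its history of values, a finite sequence that can be coded by
    digits. *)
Lemma prim_graphP k (F : k.-tuple nat -> nat -> Prop)
    (G : k.+2.-tuple nat -> nat -> Prop) a x v :
  prim_graph F G a x v <->
  exists u : nat -> nat, [/\ F x (u 0),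
    forall b, b < a -> G [tuple of [:: b, u b & x]] (u b.+1) & u a = v].
Proof.
elim: a v => [|a IH] v /=; first by split=> [Fv|[u [Fu _ <-]]//]; exists (fun=> v).
split=> [[c /IH[u [Fu Gu uc]] Gc]|[u [Fu Gu uv]]].
  exists (fun i => if i <= a then u i else v); rewrite leq0n ltnn; split=> // b.
  rewrite ltnS => ba; rewrite ba; case: ltnP => [/Gu//|ab].
  by have -> : b = a; [apply/eqP; rewrite eqn_leq ba|rewrite uc].
exists (u a); last by rewrite -uv; apply: Gu.
by apply/IH; exists u; split=> // b /leqW/Gu.
Qed.

Lemma pre_scons2 k a b (e : env) :
  pre k.+2 (a .: b .: e) = [tuple of [:: a, b & pre k e]].
Proof. by rewrite !pre_scons; apply: val_inj. Qed.

(** A halting computation uses finitely many positive and negative oracle answers, and both kinds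
    are r.e. by hypothesis. The value is [e 0]; the arguments follow. *)
Lemma ure_eval (X : (nat -> bool) -> set nat) :
  ure C (fun P e => X P (e 0)) -> ure C (fun P e => ~ X P (e 0)) ->
  forall k (f : recfun k),
  ure C (fun P e => recfun_eval (X P) f (pre k (shift e)) (e 0)).
Proof.
move=> Xr nXr k; have projr := recE_proj C.
have eqr F G : recE C F -> recE C G -> ure C (fun _ e => F e = G e).
  move=> Fr Gr; apply: (ure_ext (ure_rec (recB_eq Fr Gr))) => _ e.
  by split=> /eqP.
elim=> {k} /= [k||k i||k l f IHf g IHg|k f IHf g IHg|k f IHf].
- exact: eqr (recE_const C 0).
- apply: (ure_ext (eqr _ _ (projr 0) (recE_succ (projr 1)))) => P e.
  by rewrite thead_pre.
- apply: (ure_ext (eqr _ _ (projr 0) (projr i.+1))) => P e.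
  by rewrite tnth_mktuple.
- have argr i : recE C (fun e => shift e i) by apply: projr.
  apply: (ure_ext (ure_or (ure_and (ure_comp Xr argr) (eqr _ _ (projr 0) (recE_const C 1)))
    (ure_and (ure_comp nXr argr) (eqr _ _ (projr 0) (recE_const C 0))))) => P e.
  by rewrite thead_pre.
- apply: (ure_ext (ure_ex_tuple (D := fun P y e =>
    (forall i, recfun_eval (X P) (g i) (pre l (shift e)) (tnth y i)) /\
    recfun_eval (X P) f y (e 0)) _)); last first.
    by move=> P e; split=> [[y [gy fy]]|[y gy fy]]; exists y.
  apply: ure_and.
    apply: ure_all => i.
    (* The intermediate tuple occupies the first [k] entries; entry [k] is the final value and the
       original arguments follow it. *)
    pose Y (e : env) := e i .: fun j => e (k + j.+1).
    have Yr : forall j, recE C (fun e => Y e j) by apply: recE_scons.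
    by apply: (ure_ext (ure_comp (IHg i) Yr)) => P e; rewrite tnth_mktuple.
  pose Y (e : env) := e k .: e.
  have Yr : forall j, recE C (fun e => Y e j) by apply: recE_scons.
  by apply: (ure_ext (ure_comp IHf Yr)) => P e; rewrite addn0.
- apply: (ure_ext (ure_ex (D := fun P N e => exists w,
    [/\ recfun_eval (X P) f (pre k (shift (shift e))) (digit N w 0),
        forall b, b < e 1 -> recfun_eval (X P) g
          (pre k.+2 (b .: digit N w b .: shift (shift e))) (digit N w b.+1) &
        digit N w (e 1) = e 0]) _)); last first.
    move=> P e; rewrite thead_pre behead_pre; split=> [[N [w [fw gw we]]]|].
      by apply/prim_graphP; exists (digit N w); split=> // b /gw; rewrite pre_scons2.
    move=> /prim_graphP[u [fu gu ue]].
    have [N [w wP]] := digit_exist u (e 1).+1; exists N, w; split.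
    + by rewrite wP.
    + by move=> b be; rewrite pre_scons2 !wP ?(leqW be) //; apply: gu.
    + by rewrite wP.
  apply: ure_ex.
  apply: (ure_ext (ure_and (ure_and
    (ure_comp (X := fun e => digit (e 1) (e 0) 0 .: fun j => e j.+4) IHf _)
    (ure_ball (D := fun P b e => recfun_eval (X P) g
          (pre k.+2 (b .: digit (e 1) (e 0) b .: fun j => e j.+4))
          (digit (e 1) (e 0) b.+1)) (N := fun e => e 3) _ _))
    (eqr (fun e => digit (e 1) (e 0) (e 3)) (fun e => e 2) _ _))) => //.
  + by apply: recE_scons => //; apply: recE_digit => //; apply: recE_const.
  + apply: (ure_comp (X := fun e => digit (e 2) (e 1) (e 0).+1 .: e 0 .:
      digit (e 2) (e 1) (e 0) .: fun j => e j.+4.+1) IHg).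
    by do !apply: recE_scons => //; apply: recE_digit => //; apply: recE_succ.
  + exact: recE_digit.
  + by move=> P e; split=> [[[? ?] ?]|[? ? ?]].
(* The value [e 0] of the minimization bounds the arguments [w] at which [f] must converge to a
   positive number. *)
- apply: (ure_ext (ure_and
    (ure_comp (X := fun e => 0 .: e) IHf _)
    (ure_ball (D := fun P w e => exists u,
       recfun_eval (X P) f (pre k.+1 (w .: shift e)) u.+1) _ (projr 0)))).
  + exact: recE_scons (recE_const C 0) projr.
  + apply: ure_ex.
    apply: (ure_comp (X := fun e => (e 0).+1 .: e 1 .: fun j => e j.+3) IHf).
    by do !apply: recE_scons => //; apply: recE_succ.
  + by move=> P e; rewrite -preS; split=> -[f0 fw]; split=> // w /fw[u fu];
      exists u; rewrite ?pre_scons // -pre_scons.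
Qed.

(** By compactness, [D] holds for all [P] iff at some length [l] all [2 ^ l] prefixes are accepted
    at once, and this test is recursive. *)
Lemma ure_Sigma1 k D : ure C D ->
  Sigma1_in C [set x : k.-tuple nat | forall P, D P (nth 0 x)].
Proof.
move=> [b [br bS bP]].
pose c (e : env) := all (fun w => b (e 0 .: w .: shift e)) (iota 0 (2 ^ e 0)).
have cr : recB C c.
  apply: recB_ball; last first.
    by apply: recE_exp; [apply: recE_const|apply: recE_proj].
  apply: (recE_comp (X := fun e => e 1 .: e 0 .: shift (shift e)) br).
  by do !(apply: recE_scons; first exact: recE_proj); move=> i; apply: recE_proj.
exists [set z : k.+1.-tuple nat | c (nth 0 z)].
  have [K [f fP]] := cr.
  (* The arity [K] may exceed [k.+1]; the missing arguments are set to 0, the default value of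
     [nth]. *)
  exists (RComp f (fun i : 'I_K =>
    if insub (i : nat) is Some j then RProj j else RZero k.+1)) => z.
  have evalz : exists2 y : K.-tuple nat, (forall i : 'I_K,
      recfun_eval C (if insub (i : nat) is Some j then RProj j else RZero k.+1)
        z (tnth y i)) & recfun_eval C f y (c (nth 0 z)).
    exists (pre K (nth 0 z)) => // i; rewrite tnth_mktuple.
    case: insubP => [j _ <-|] /=; first by rewrite (tnth_nth 0).
    by rewrite -leqNgt => ki; rewrite nth_default // size_tuple.
  by split=> /= cz; move: evalz; [rewrite cz|rewrite (negPf (introN idP cz))].
move=> x /=.
have nth_cons y : nth 0 (y :: x) = y .: nth 0 x by apply/funext => -[].
split=> [Dx|[y]]; last first.
  rewrite nth_cons => /allP cy P; apply/bP; exists y.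
  by apply: cy; rewrite mem_iota; apply: pw_lt.
apply: contrapT => /forallNP ncover.
have [||l|P PP] := @increasing_open_not_cover
    (fun l => [set P | b (l .: pw P l .: nth 0 x)]).
- by move=> l P bl; exists l => Q QP; rewrite /= (pw_ext QP).
- by move=> l P /bS.
- have := ncover l; rewrite nth_cons => /negP/allPn[w].
  rewrite mem_iota /= add0n => wl /negP bw.
  by exists (bit w); rewrite pw_bit.
by have /bP[l /PP] := Dx P.
Qed.

End UniformlyRe.

(** * Computations with the oracle [P + C] *)

Lemma recfun_eval_functional X k (f : recfun k) x v w :
  recfun_eval X f x v -> recfun_eval X f x w -> v = w.
Proof.
elim: f x v w => {k} /= [k||k i||k l f IHf g IHg|k f IHf g IHg|k f IHf] x v w.
- by move=> -> ->.
- by move=> -> ->.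
- by move=> -> ->.
- by move=> [[? ->]|[? ->]] [[? ->]|[? ->]].
- move=> [y gy fy] [z gz fz]; have yz : y = z.
    by apply: eq_from_tnth => i; apply: IHg (gy i) (gz i).
  by rewrite yz in fy; apply: IHf fy fz.
- elim: (thead x) v w => [|a IH] v w /=; first exact: IHf.
  move=> [u hu gv] [u' hu' gw]; rewrite (IH _ _ hu hu') in gv.
  exact: IHg gv gw.
move=> [fv ltv] [fw ltw]; case: (ltngtP v w) => // [/ltw|/ltv] [u fu].
  by have := IHf _ _ _ fv fu.
by have := IHf _ _ _ fw fu.
Qed.

Lemma computable_in_eval X k (R : set (k.-tuple nat)) :
  computable_in X R -> exists f : recfun k, forall x, R x <-> recfun_eval X f x 1.
Proof.
move=> [f fR]; exists f => x; split=> [/(fR x).1//|f1].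
apply: contrapT => /(fR x).2 f0.
by have := recfun_eval_functional f0 f1.
Qed.

Lemma Sigma1_in_eval X k (R : set (k.-tuple nat)) : Sigma1_in X R ->
  exists f : recfun k.+1, forall x,
    R x <-> exists y, recfun_eval X f [tuple of y :: x] 1.
Proof.
move=> [S /computable_in_eval[f fS] RS]; exists f => x; rewrite RS.
by split=> -[y /fS]; exists y => //; apply/fS.
Qed.

Lemma recB_computable_in C (A : set nat) :
  computable_in C [set x : 1.-tuple nat | A (thead x)] ->
  recB C (fun e => `[< A (e 0) >]).
Proof.
move=> [f fA]; exists 1, f => e; have := fA (pre 1 e); rewrite /= thead_pre.
by move=> [f1 f0]; case: asboolP => /= ?; [apply: f1|apply: f0].
Qed.

Definition path_join (P : nat -> bool) (C : set nat) := join [set k | P k] C.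

(** Odd queries are answered recursively in [C], and even ones from a finite prefix of [P]. *)
Lemma ure_eval_join C k (f : recfun k) :
  ure C (fun P e => recfun_eval (path_join P C) f (pre k (shift e)) (e 0)).
Proof.
pose half (e : env) : env := fun=> (e 0)./2.
have halfr i : recE C (fun e => half e i).
  apply: (recE_ext (recE_div (recE_proj C 0) (recE_const C 2))) => e.
  by rewrite divn2.
have oddr : recB C (fun e => odd (e 0)).
  apply: (recE_ext (recB_bit (recE_proj C 0) (recE_const C 0))) => e.
  by rewrite bit0.
have Cr := recB_oracle C.
apply: (ure_eval (X := fun P => path_join P C)).
  apply: (ure_ext (ure_or
    (ure_and (ure_rec oddr) (ure_comp (X := half) (ure_rec Cr) halfr))
    (ure_and (ure_rec (recB_not oddr)) (ure_comp (X := half) (ure_oracle C true) halfr)))).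
  move=> P e /=; rewrite /path_join /join /=; case: (odd (e 0)) => /=.
    by split=> [[[_ /asboolP]|[]]//|]; left; split=> //; apply/asboolP.
  by split=> [[[]|[]]//|]; right.
apply: (ure_ext (ure_or
  (ure_and (ure_rec oddr) (ure_comp (X := half) (ure_rec (recB_not Cr)) halfr))
  (ure_and (ure_rec (recB_not oddr)) (ure_comp (X := half) (ure_oracle C false) halfr)))).
move=> P e /=; rewrite /path_join /join /=; case: (odd (e 0)) => /=.
  by split=> [[[_ /asboolPn]|[]]//|]; left; split=> //; apply/asboolPn.
by split=> [[[]//|[_ ->]]//|/negP/negPf]; right.
Qed.

Lemma ure_pw C : ure C (fun P e => pw P (e 0) = e 1).
Proof.
have projr := recE_proj C.
apply: (ure_ext (ure_and
  (ure_rec (recB_leq (recE_succ (projr 1)) (recE_exp (recE_const C 2) (projr 0))))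
  (ure_ball (D := fun P i e => bit (e 1) i = P i) _ (projr 0)))); last first.
  by move=> P e; rewrite pw_eqP.
have bitr : recB C (fun e => bit (e 2) (e 0)) by apply: recB_bit.
apply: (ure_ext (ure_or
  (ure_and (ure_rec bitr) (ure_oracle C true))
  (ure_and (ure_rec (recB_not bitr)) (ure_oracle C false)))) => P e /=.
rewrite /shift; case: (bit _ _); case: (P _); split=> //.
- by left.
- by move=> [] [].
- by move=> [] [].
- by right.
Qed.

Lemma ure_open C D : ure C D -> forall P e, D P e ->
  exists l, forall Q, (forall i, i < l -> Q i = P i) -> D Q e.
Proof.
move=> [b [_ _ bP]] P e /bP[l bl]; exists l => Q QP.
by apply/bP; exists l; rewrite (pw_ext QP).
Qed.

(** * Rationals, intervals and assignments through their codes *)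

Section Coding.
Variables (code : rat -> nat) (decode : nat -> rat).
Hypotheses (codeK : cancel code decode) (decodeK : cancel decode code).

Lemma bit_fset_code S x : bit (fset_code code S) (code x) = (x \in S).
Proof.
have -> : fset_code code S = \sum_(c <- map code S) 2 ^ c by rewrite big_map.
rewrite bit_sum ?(map_inj_uniq (can_inj codeK)) ?fset_uniq //.
by rewrite (mem_map (can_inj codeK)).
Qed.

Lemma sum_expn2_surj t : exists2 s : seq nat, uniq s & \sum_(c <- s) 2 ^ c = t.
Proof.
elim/ltn_ind: t => -[|t] IH; first by exists [::]; rewrite ?big_nil.
have [|s us sE] := IH t.+1./2; first by rewrite -divn2 ltn_Pdiv.
(* The exponents for half the number are raised by one, and exponent 0 is added if the number is
   odd. *)
exists (nseq (odd t.+1) 0 ++ map succn s).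
  rewrite cat_uniq map_inj_uniq ?us ?andbT; last exact: succn_inj.
  apply/andP; split; first by case: odd.
  by apply/hasPn => _ /mapP[c _ ->]; case: odd.
rewrite -[RHS]odd_double_half -sE big_cat /= big_nseq big_map; congr (_ + _).
  by case: odd.
rewrite -mul2n big_distrr /=; apply: eq_bigr => c _; exact: expnS.
Qed.

Lemma fset_code_surj t : exists S, fset_code code S = t.
Proof.
have [s us <-] := sum_expn2_surj t.
exists [fset x in map decode s]%fset; rewrite /fset_code.
have -> : \sum_(c <- s) 2 ^ c = \sum_(x <- map decode s) 2 ^ code x.
  by rewrite big_map; apply: eq_bigr => c _; rewrite decodeK.
apply: perm_big; apply: uniq_perm; first exact: fset_uniq.
  by rewrite (map_inj_uniq (can_inj decodeK)).
by move=> x; rewrite in_fset.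
Qed.

Section Assignments.
Variables m n : nat.
Implicit Types V W : assignment m n.

Lemma nth_assignment_code V v :
  nth 0 (assignment_code code V) (enum_rank v) = fset_code code (V v).
Proof.
rewrite (nth_image 0).
by rewrite enum_rankK.
Qed.

Lemma assignment_code_surj t : exists V, assignment_code code V = t.
Proof.
have /choice[V VP] v : exists S, fset_code code S = tnth t (enum_rank v).
  exact: fset_code_surj.
exists V; apply: tuple_eq_nth => i ik.
have -> : i = enum_rank (enum_val (Ordinal ik)) by rewrite enum_valK.
by rewrite nth_assignment_code VP (tnth_nth 0).
Qed.

(** Canonical indices turn assignments into tuples bijectively. The bound [c < tnth t i] loses
    nothing by [bit_lt] and makes the quantifier over [c] bounded. *)
Lemma ex_tuple_assignment (K : 'I_#|mx_var m n| -> nat -> Prop)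
    (Phi : #|mx_var m n|.-tuple nat -> Prop) :
  (exists t, (forall i c, c < tnth t i -> bit (tnth t i) c -> K i c) /\ Phi t) <->
  exists V, (forall v x, x \in V v -> K (enum_rank v) (code x)) /\
            Phi (assignment_code code V).
Proof.
have bitE V i c : bit (tnth (assignment_code code V) i) c =
    (decode c \in V (enum_val i)).
  rewrite (tnth_nth 0) -{1}(enum_valK i) nth_assignment_code.
  by rewrite -{1}(decodeK c) bit_fset_code.
split=> [[t [tK Pt]]|[V [VK PV]]].
  have [V Vt] := assignment_code_surj t; exists V; rewrite Vt; split=> // v x xV.
  have xt : bit (tnth t (enum_rank v)) (code x).
    by rewrite -Vt bitE codeK enum_rankK.
  exact: tK (bit_lt xt) xt.
exists (assignment_code code V); split=> // i c _; rewrite bitE => /VK.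
by rewrite enum_valK decodeK.
Qed.

End Assignments.

Lemma ure_lt C : computable_coding code ->
  ure C (fun _ e => (decode (e 0) < decode (e 1))%R).
Proof.
move=> [_ /computable_in_eval[f fP]].
have evalr := ure_eval (X := fun=> set0) (ure_const C False) (ure_const C (~ False)) f.
have Xr : forall i, recE C (fun e => (1 .: e) i).
  exact: recE_scons (recE_const C 1) (recE_proj C).
apply: (ure_ext (ure_comp evalr Xr)) => _ e.
rewrite /= -[shift _]/e -fP /= !tnth_mktuple; split=> [[x [y [xe ye xy]]]|xy].
  by rewrite -xe -ye !codeK.
by exists (decode (e 0)), (decode (e 1)); rewrite !decodeK.
Qed.

Lemma ure_itv C (I : interval rat) : computable_coding code ->
  ure C (fun _ e => decode (e 0) \in I).
Proof.
move=> /(ure_lt C) ltr; have projr := recE_proj C.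
have gtr (a : rat) : ure C (fun _ e => (a < decode (e 0))%R).
  have Xr : forall i, recE C (fun e => (code a .: e) i).
    exact: recE_scons (recE_const C _) projr.
  by apply: (ure_ext (ure_comp ltr Xr)) => P e /=; rewrite codeK.
have {}ltr (a : rat) : ure C (fun _ e => (decode (e 0) < a)%R).
  have Xr : forall i, recE C (fun e => (e 0 .: code a .: e) i).
    by apply: recE_scons => //; apply: recE_scons => //; apply: recE_const.
  by apply: (ure_ext (ure_comp ltr Xr)) => P e /=; rewrite codeK.
have eqr (a : rat) : ure C (fun _ e => decode (e 0) = a).
  apply: (ure_ext (ure_rec (recB_eq (projr 0) (recE_const C (code a))))) => _ e.
  by split=> [/eqP->|<-]; rewrite ?codeK ?decodeK.
have ler a : ure C (fun _ e => (a <= decode (e 0))%R).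
  apply: (ure_ext (ure_or (eqr a) (gtr a))) => P e; rewrite Order.POrderTheory.le_eqVlt.
  by rewrite eq_sym; split=> [[->|->]|/predU1P]; rewrite ?eqxx ?orbT.
have ger a : ure C (fun _ e => (decode (e 0) <= a)%R).
  apply: (ure_ext (ure_or (eqr a) (ltr a))) => P e; rewrite Order.POrderTheory.le_eqVlt.
  by split=> [[->|->]|/predU1P]; rewrite ?eqxx ?orbT.
case: I => [l r].
apply: (ure_ext (ure_and
  (D := fun _ e => (l <= BLeft (decode (e 0)))%O)
  (E := fun _ e => (BRight (decode (e 0)) <= r)%O) _ _)); last first.
- by move=> P e; rewrite itv_boundlr; split=> [[-> ->]|/andP].
(* The cases [BLeft b], [BRight b], [-oo], [+oo] mean [x < b], [x <= b], false and true for
   [x = decode (e 0)]. *)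
- case: r => [[] b|[]].
  + by apply: (ure_ext (ltr b)) => P e; rewrite bnd_simp.
  + by apply: (ure_ext (ger b)) => P e; rewrite bnd_simp.
  + by apply: (ure_ext (ure_const C False)) => P e; rewrite bnd_simp.
  + by apply: (ure_ext (ure_const C True)) => P e; rewrite bnd_simp.
case: l => [[] b|[]].
- by apply: (ure_ext (ler b)) => P e; rewrite bnd_simp.
- by apply: (ure_ext (gtr b)) => P e; rewrite bnd_simp.
- by apply: (ure_ext (ure_const C True)) => P e; rewrite bnd_simp.
- by apply: (ure_ext (ure_const C False)) => P e; rewrite bnd_simp.
Qed.

End Coding.

Definition halts C k (f : recfun k.+1) (P : nat -> bool) (t : k.-tuple nat) :=
  exists y, recfun_eval (path_join P C) f [tuple of y :: t] 1.

(** The common form of the two r.e. sets in the forcing step: [K] is bitwise containment in given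
    sets, or membership in prescribed intervals above a bound. *)
Lemma ure_ex_halts C k (f : recfun k.+1) (K : 'I_k -> nat -> env -> Prop) :
  (forall i, ure C (fun _ e => K i (e 0) (shift e))) ->
  ure C (fun P e => exists t : k.-tuple nat,
    (forall i c, c < tnth t i -> bit (tnth t i) c -> K i c e) /\ halts C f P t).
Proof.
move=> Kr; have projr := recE_proj C.
apply: (ure_ex_tuple (D := fun P (t : k.-tuple nat) e =>
  (forall i c, c < tnth t i -> bit (tnth t i) c -> K i c e) /\ halts C f P t)).
apply: ure_and.
  apply: ure_all => i.
  apply: (ure_ext (ure_ball (D := fun P c e => ~~ bit (e i) c \/
    K i c (fun j => e (k + j))) _ (projr i))); last first.
    move=> P e; rewrite tnth_mktuple.
    split=> KP c /KP; first by case=> [/negPf->|].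
    by case: (bit _ _) => [KPc|_]; [right; apply: KPc|left].
  apply: ure_or; first exact/ure_rec/recB_not/(recB_bit (projr i.+1) (projr 0)).
  apply: (ure_comp (X := fun e => e 0 .: fun j => e (k + j).+1) (Kr i)).
  exact: recE_scons.
apply: ure_ex; apply: (ure_ext (ure_comp (X := scons 1) (ure_eval_join C f) _)).
  by apply: recE_scons => //; apply: recE_const.
by move=> P e; rewrite /= preS.
Qed.

(** * Countability of the indices, and paths leaving the tree *)

(** Embeds indices into a countable type so that requirements can be numbered. A composition stores
    its inner arity, which its type does not show. *)
Fixpoint recfun_tree k (f : recfun k) : GenTree.tree nat :=
  match f with
  | RZero k => GenTree.Node 0 [::]
  | RSucc => GenTree.Node 1 [::]
  | RProj k i => GenTree.Node 2 [:: GenTree.Leaf (i : nat)]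
  | ROracle => GenTree.Node 3 [::]
  | RComp k l f g => GenTree.Node 4
      [:: GenTree.Leaf k, recfun_tree f & [seq recfun_tree (g i) | i <- enum 'I_k]]
  | RPrim k f g => GenTree.Node 5 [:: recfun_tree f; recfun_tree g]
  | RMin k f => GenTree.Node 6 [:: recfun_tree f]
  end.

Lemma recfun_tree_inj k : injective (@recfun_tree k).
Proof.
(* Equality proofs on [nat] are unique. Packing an index with its arity lets the induction compare
   terms of different types. *)
have existT_inj j (f g : recfun j) : existT recfun j f = existT recfun j g -> f = g.
  by move=> fg; have := projT2_eq fg; rewrite (eq_axiomK (projT1_eq fg)).
suff inj (f : recfun k) l (g : recfun l) : k = l ->
    recfun_tree f = recfun_tree g -> existT recfun k f = existT recfun l g.
  by move=> f g /(inj f k g erefl)/existT_inj.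
elim: f l g => {k} [k||k i||k k' f IHf h IHh|k f IHf h IHh|k f IHf] l
  [l'||l' j||l' l'' g h'|l' g h'|l' g] //=.
- by move=> <-.
- by move=> kl; move: j; rewrite -kl => j [/val_inj->].
- move=> kl [e]; move: h' g; rewrite -kl -e => h' g fg /eq_in_map hh'.
  have -> := existT_inj _ _ _ (IHf _ g erefl fg).
  suff -> : h = h' by [].
  apply/funext => i; apply/existT_inj/IHh => //; apply: hh'.
  by rewrite mem_enum.
- move=> [kl]; move: g h'; rewrite -kl => g h' [fg hh'].
  have -> := existT_inj _ _ _ (IHf _ g erefl fg).
  by have -> := existT_inj _ _ _ (IHh _ h' erefl hh').
move=> kl; move: g; rewrite -kl => g [fg].
by have -> := existT_inj _ _ _ (IHf _ g erefl fg).
Qed.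

(** There are finitely many strings shorter than [j], so [T] has a longer one, which is
    truncated. *)
Lemma infinite_tree_levels (T : set (seq bool)) j :
  binary_tree T -> infinite_set T -> exists P, T (mkseq P j).
Proof.
move=> Ttree Tinf.
have [s Ts js] : exists2 s, T s & j <= size s.
  apply: contrapT => short; apply: Tinf.
  apply: (@sub_finite_set _ _ (\bigcup_(i in [set i | i < j])
    (@tval i bool @` [set: i.-tuple bool]))); last first.
    apply: bigcup_finite; first exact: finite_II.
    by move=> i _; apply: finite_image; apply: finite_finset.
  move=> s Ts; exists (size s); last by exists (in_tuple s).
  by rewrite /= ltnNge; apply/negP => js; apply: short; exists s.
exists (nth false s); apply: Ttree Ts; rewrite prefixE size_mkseq.
apply/eqP/(@eq_from_nth _ false); first by rewrite size_takel ?size_mkseq.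
by move=> i; rewrite size_takel // => ij; rewrite nth_take // nth_mkseq.
Qed.

Lemma ure_off_tree (C : set nat) (T : set (seq bool)) : computable_tree C T ->
  ure C (fun P _ => exists l, ~ T (mkseq P l)).
Proof.
move=> Tc; have projr := recE_proj C.
have Tr := recB_not (recB_computable_in
  (A := fun c => exists2 s, T s & string_code s = c) Tc).
(* By [string_code_mkseq], [(w + 2 ^ l).-1] is the string code of the prefix of length [l] with
   binary value [w]. *)
apply: (ure_ext (ure_ex (D := fun P l _ => exists w, pw P l = w /\
  ~~ `[< exists2 s, T s & string_code s = (w + 2 ^ l).-1 >]) _)); last first.
  move=> P _; split=> -[l].
    move=> [_ [<- /asboolPn nT]]; exists l => Tl; apply: nT.
    by exists (mkseq P l); rewrite // -string_code_mkseq.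
  move=> nT; exists l, (pw P l); split=> //; apply/asboolPn => -[s Ts].
  by rewrite -string_code_mkseq => /string_code_inj sl; apply: nT; rewrite -sl.
apply: ure_ex; apply: ure_and.
  apply: (ure_comp (X := fun e => e 1 .: e 0 .: e) (ure_pw C)).
  by do !apply: recE_scons => //.
apply: (ure_comp (X := fun e => (e 0 + 2 ^ e 1).-1 .: e) (ure_rec Tr)).
apply: recE_scons => //; apply: recE_pred; apply: recE_add => //.
by apply: recE_exp => //; apply: recE_const.
Qed.

(** * Forcing a single requirement *)

Section Step.
Variables (code : rat -> nat) (decode : nat -> rat).
Hypotheses (codeK : cancel code decode) (decodeK : cancel decode code).
Hypothesis code_computable : computable_coding code.
Variables (n : nat) (A0 A1 : set rat) (C : set nat).
Hypothesis C_fair : ER_fair code n A0 A1 C.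

Definition halts_at m k (f : recfun #|mx_var m k|.+1) (P : nat -> bool) : mx_formula m k :=
  [set V | halts C f P (assignment_code code V)].

(** Fairness for the formula with index [f], with essentiality restricted to the one type [T]. *)
Definition requirement m (M : 'M[rat]_(m, 2 ^ n * m))
    (f : recfun #|mx_var m (2 ^ n * m)|.+1) (T : m.-tuple (interval rat))
    (P : nat -> bool) : Prop :=
  (exists V, [/\ mx_valuation M V, diagonalizes A0 A1 V & halts_at f P V]) \/
  ~ (exists Is, [/\ mx_partition M Is, itv_type Is T &
       type_essential code M T (halts_at f P)]).

Definition var_itv m k (M : 'M[rat]_(m, k)) (T : m.-tuple (interval rat))
    (v : mx_var m k) : interval rat :=
  match v with inl j => tnth T j | inr (i, j) => row_itv M i j end.

Lemma var_itvP m k (M : 'M[rat]_(m, k)) T V :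
  (mx_valuation M V /\ of_type T V) <->
  forall v x, x \in V v -> x \in var_itv M T v.
Proof.
split=> [[MV TV] [j|[i j]] x xV|VI].
- exact: TV xV.
- exact: MV xV.
by split=> [i j x xV|j x xV]; apply: (VI _ _ xV).
Qed.

Lemma requirement_step m (M : 'M[rat]_(m, 2 ^ n * m)) f T
    (U : (nat -> bool) -> Prop) :
  increasing_rows M -> ure C (fun P _ => U P) -> (exists P, ~ U P) ->
  exists U' : (nat -> bool) -> Prop,
    [/\ ure C (fun P _ => U' P), exists P, ~ U' P,
        forall P, U P -> U' P & forall P, ~ U' P -> requirement M f T P].
Proof.
move=> Minc Ur [P0 UP0]; have projr := recE_proj C.
(* The tuple [t] ranges over subsets of the sets coded by [e], which makes [DD] monotone in [e];
   [psi] demands it for every [P]. *)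
pose DD (P : nat -> bool) (e : env) := U P \/
  exists t : #|mx_var m (2 ^ n * m)|.-tuple nat,
    (forall i c, c < tnth t i -> bit (tnth t i) c -> bit (e i) c) /\ halts C f P t.
have Dr : ure C DD.
  apply: ure_or => //.
  apply: (ure_ex_halts f (K := fun i c e => bit (e i) c)) => i.
  by apply: ure_rec; apply: recB_bit (projr i.+1) (projr 0).
pose psi : mx_formula m (2 ^ n * m) :=
  [set V | forall P, DD P (nth 0 (assignment_code code V))].
have DDP V P : DD P (nth 0 (assignment_code code V)) <-> U P \/
    exists V', (forall v x, x \in V' v -> x \in V v) /\ halts_at f P V'.
  rewrite /DD (ex_tuple_assignment codeK decodeK (fun i => bit (nth 0 _ i))
    (halts C f P)).
  suff subE v x : bit (nth 0 (assignment_code code V) (enum_rank v)) (code x)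
      = (x \in V v).
    split=> -[|[V' [V'V hV']]]; [by left|right|by left|right];
      by exists V'; split=> // v x /V'V; rewrite subE.
  by rewrite nth_assignment_code (bit_fset_code codeK).
have psi_Sigma1 : Sigma1_formula code C psi.
  by eexists; first exact: ure_Sigma1 Dr.
have [[Is [MIs TIs _]]|noIs] :=
  pselect (exists Is, [/\ mx_partition M Is, itv_type Is T & True]); last first.
  (* When [T] is a type of no [M]-partition, the requirement holds vacuously. *)
  exists U; split=> //; first by exists P0.
  by move=> P _; right=> -[Is [MIs TIs _]]; apply: noIs; exists Is.
have [psi_ess|] := pselect (type_essential code M T psi).
  have [|V [MV [V1 V0] /(_ P0)/DDP]] := C_fair Minc psi_Sigma1.
    by exists Is, T.
  case=> // -[V' [V'V haltsV']].
  have Hr : ure C (fun P e => halts C f P (pre #|mx_var m (2 ^ n * m)| e)).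
    apply: ure_ex.
    apply: (ure_ext (ure_comp (X := scons 1) (ure_eval_join C f) _)) => [|P e].
      by apply: recE_scons => //; apply: recE_const.
    by rewrite /= preS.
  have [|l lP] := ure_open Hr (P := P0) (e := nth 0 (assignment_code code V')).
    by rewrite pre_nth.
  (* Keeps only the [P] outside [U] that agree with [P0] on its first [l] bits, which force halting
     on [V']. *)
  exists (fun P => U P \/ exists w, pw P l = w /\ w != pw P0 l); split.
  - apply: (ure_or Ur); apply: ure_ex; apply: ure_and.
      apply: (ure_comp (X := fun e => l .: e) (ure_pw C)).
      by apply: recE_scons => //; apply: recE_const.
    by apply: ure_rec; apply: recB_not (recB_eq (projr 0) (recE_const C _)).
  - by exists P0 => -[//|[_ [<-]]]; rewrite eqxx.
  - by left.
  move=> P /not_orP[_ agree]; left; exists V'; split.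
  (* Being a valuation and diagonalizing are inherited by smaller sets, hence pass from [V] to
     [V']. *)
  - by move=> i k x /V'V; apply: MV.
  - split=> [x [j _ /V'V xV]|i]; first by apply: V1; exists j.
    by have [k kV] := V0 i; exists k => x /V'V; apply: kV.
  rewrite /halts_at /= -(pre_nth (assignment_code _ _)); apply: lP => i il.
  rewrite -(bit_pw P0 il) -(bit_pw P il); congr bit.
  by apply: contrapT => /eqP ne; apply: agree; exists (pw P l).
move=> /existsNP[s /forallNP not_psi].
pose K (v : mx_var m (2 ^ n * m)) c := s < c /\ decode c \in var_itv M T v.
exists (fun P => U P \/ exists t : #|mx_var m (2 ^ n * m)|.-tuple nat,
  (forall i c, c < tnth t i -> bit (tnth t i) c -> K (enum_val i) c) /\ halts C f P t).
have KP P : (exists t : #|mx_var m (2 ^ n * m)|.-tuple nat,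
    (forall i c, c < tnth t i -> bit (tnth t i) c -> K (enum_val i) c) /\
    halts C f P t) <->
    exists V, [/\ mx_valuation M V, valuation_gt code s V, of_type T V &
                  halts_at f P V].
  rewrite (ex_tuple_assignment codeK decodeK _ (halts C f P)).
  split=> -[V].
    move=> [VK hV]; exists V.
    have /var_itvP[MV TV] : forall v x, x \in V v -> x \in var_itv M T v.
      by move=> v x /VK[_]; rewrite enum_rankK codeK.
    by split=> // v x /VK[].
  move=> [MV Vs TV hV]; exists V; split=> // v x xV.
  rewrite enum_rankK; split; first exact: Vs xV.
  by rewrite codeK; apply: (var_itvP M T V).1 xV.
split.
- apply: (ure_or Ur).
  apply: (ure_ex_halts f (K := fun i c _ => K (enum_val i) c)) => i.
  apply: ure_and; last exact: ure_itv.
  exact: ure_rec (recB_leq (recE_const C s.+1) (projr 0)).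
(* This contains every valuation of type [T] above [s] whose codes are below [j]. *)
- pose V_ j : assignment m (2 ^ n * m) := fun v =>
    [fset x in [seq decode c | c <- iota 0 j &
                (s < c) && (decode c \in var_itv M T v)]]%fset.
  have V_P j v x : (x \in V_ j v) =
      [&& code x < j, s < code x & x \in var_itv M T v].
    rewrite in_fset; apply/mapP/idP => [[c]|/and3P[xj sx xI]].
      rewrite mem_filter mem_iota => /andP[/andP[sc cI] cj] ->.
      by rewrite decodeK; apply/and3P; split=> //; case/andP: cj.
    by exists (code x); rewrite ?codeK // mem_filter mem_iota codeK sx xI.
  pose O j : set (nat -> bool) := [set P | DD P (nth 0 (assignment_code code (V_ j)))].
  have [||j|P PO] := @increasing_open_not_cover O.
  + by move=> j P /(ure_open Dr).
  + move=> j P /DDP OP; apply/DDP; case: OP => [UP|[V' [V'V hV']]]; [by left|right].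
    exists V'; split=> // v x /V'V; rewrite !V_P => /and3P[xj -> ->].
    by rewrite ltnW.
  (* As [V_ j] has type [T] and lies above [s], [psi] fails at it, which gives a [P] outside
     [O j]. *)
  + apply/existsNP => psij; apply: (not_psi (V_ j)).
    have /var_itvP[MV TV] : forall v x, x \in V_ j v -> x \in var_itv M T v.
      by move=> v x; rewrite V_P => /and3P[].
    by split=> // v x; rewrite V_P => /and3P[].
  exists P; move=> [UP|/KP[V [MV Vs TV hV]]]; first by apply: (PO 0); left.
  (* This stage exceeds every code in [V], so [V] is contained in the valuation [V_] of that
     stage. *)
  apply: (PO (\max_(v : mx_var m (2 ^ n * m)) \max_(x <- V v) (code x).+1)).
  apply/DDP; right; exists V; split=> // v x xV; rewrite V_P (Vs _ _ xV).
  rewrite (var_itvP M T V).1 // !andbT.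
  apply: leq_trans (leq_bigmax (F := fun v => \max_(x <- V v) (code x).+1) v).
  exact: leq_bigmax_seq.
- by left.
move=> P /not_orP[_ /KP nV]; right=> -[Is' [_ _ /(_ s)]].
exact: nV.
Qed.

End Step.

(** * Meeting all requirements one after the other *)

Theorem theorem5p18 (code : rat -> nat) (code_computable : computable_coding code)
    (n : nat) (A0 A1 : set rat) (C : set nat) (C_fair : ER_fair code n A0 A1 C)
    (T : set (seq bool)) (T_tree : binary_tree T)
    (T_computable : computable_tree C T) (T_infinite : infinite_set T) :
  exists P : nat -> bool,
    infinite_path T P /\ ER_fair code n A0 A1 (join [set k | P k] C).
Proof.
have [[decode codeK decodeK] _] := code_computable.
pose condition := {U : (nat -> bool) -> Prop |
  ure C (fun P _ => U P) /\ exists P, ~ U P}.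
have [off offE] : exists U : condition,
    sval U = (fun P => exists l, ~ T (mkseq P l)).
  unshelve eexists (exist _ (fun P => exists l, ~ T (mkseq P l)) _) => //.
  split; first exact: ure_off_tree.
  (* Leaving [T] is permanent by closure under prefixes, and [T] has strings of every length, so
     compactness gives a path. *)
  have [||j|P PT] := @increasing_open_not_cover (fun l => [set P | ~ T (mkseq P l)]).
  - move=> l P nT; exists l => Q QP.
    suff -> : [set P | ~ T (mkseq P l)] Q = ~ T (mkseq P l) by [].
    by congr (~ T _); apply/eq_in_map => i; rewrite mem_iota => /QP.
  - by move=> l P nT TS; apply/nT/T_tree/TS; rewrite mkseqS prefix_rcons.
  - by have [P PT] := infinite_tree_levels j T_tree T_infinite; exists P.
  by exists P => -[l]; apply: PT.
(* Matrix, tree of the index, and type all range over countable types, so [pickle] numbers the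
   requirements. *)
pose key := {m : nat & ('M[rat]_(m, 2 ^ n * m) * GenTree.tree nat *
                        m.-tuple (interval rat))%type}.
pose meets (j : nat) P := forall m (M : 'M[rat]_(m, 2 ^ n * m))
    (f : recfun #|mx_var m (2 ^ n * m)|.+1) S,
  choice.unpickle j = Some (Tagged _ (M, recfun_tree f, S) : key) ->
  increasing_rows M -> requirement code A0 A1 C M f S P.
have step (Uj : condition * nat) : exists U' : condition,
    (forall P, sval Uj.1 P -> sval U' P) /\
    forall P, ~ sval U' P -> meets Uj.2 P.
  case: Uj => [[U [Ur Uproper]] j] /=.
  have [[m [M [f [S [jE Minc]]]]]|none] := pselect (exists m
      (M : 'M[rat]_(m, 2 ^ n * m)) (f : recfun #|mx_var m (2 ^ n * m)|.+1) S,
      choice.unpickle j = Some (Tagged _ (M, recfun_tree f, S) : key) /\ increasing_rows M);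
      last first.
    exists (exist _ U (conj Ur Uproper)); split=> // P _ m M f S jE Minc.
    by case: none; exists m, M, f, S.
  have [U' [U'r U'proper UU' U'req]] := requirement_step codeK decodeK
    code_computable C_fair f S Minc Ur Uproper.
  exists (exist _ U' (conj U'r U'proper)); split=> //= P /U'req req.
  move=> m' M' f' S'; rewrite jE => /Some_inj key_eq _.
  (* The number [j] determines its key; after transport along [m = m'], injectivity of [recfun_tree]
     identifies the data. *)
  have mm' : m = m' := projT1_eq key_eq.
  case: m' / mm' M' f' S' key_eq => M' f' S' /eqP.
  by rewrite eq_Tagged => /eqP[<- /recfun_tree_inj<- <-].
have [next nextP] := choice step.
(* Requirement [j] is treated in passing to [O j.+1]. Compactness then gives a [P] outside every
   [O j]. *)
pose O := fix O j := if j is i.+1 then next (O i, i) else off.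
have [j P|j P|j|P PO] := @increasing_open_not_cover (fun j => sval (O j)).
- by have [Or _] := svalP (O j); apply: (@ure_open _ _ Or P (fun=> 0)).
- exact: (nextP (O j, j)).1.
- by have [_] := svalP (O j).
exists P; split=> [l|].
  by apply: contrapT => nT; apply: (PO 0); rewrite /= offE; exists l.
move=> m M Minc phi [R /Sigma1_in_eval[f fR] phiR] [Is [S [MIs SIs ess]]].
have phiE : phi = halts_at code C f P.
  by apply/funext => V; apply/propext; rewrite phiR fR.
(* Since [P] avoids [O j.+1], it meets the requirement for this formula and the type [S] that
   witnesses essentiality. *)
pose j := choice.pickle (Tagged _ (M, recfun_tree f, S) : key).
have [|[V [MV VA hV]]|] := (nextP (O j, j)).2 P (PO j.+1) m M f S _ Minc.
- exact: choice.pickleK.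
- by exists V; rewrite phiE.
by case; exists Is; rewrite -phiE.
Qed.
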